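(* Let $(M,\varphi_i,\xi_i,\eta_i,g)$, $i=1,2,3$, be a $3$-$(\alpha,\delta)$-Sasaki manifold, and let $a,b,c$ be real numbers with $a>0$, $a+b>0$, $c\neq0$, $c^2=a+b$. Then the $\mathcal H$-homothetic deformation $$\eta_i'=c\,\eta_i,\qquad \xi_i'=\tfrac1c\,\xi_i,\qquad \varphi_i'=\varphi_i,\qquad g'=a\,g+b\sum_{i=1}^3\eta_i\otimes\eta_i$$ is a $3$-$(\alpha',\delta')$-Sasaki manifold with $$\alpha'=\alpha\,\frac ca,\qquad \delta'=\frac{\delta}{c}.$$ In particular, $\alpha'\delta'$ has the same sign as $\alpha\delta$, and the $\mathcal H$-homothetic deformation is degenerate (i.e. $\delta'=0$) if and only if the undeformed $3$-$(\alpha,\delta)$-Sasaki manifold is degenerate (i.e. $\delta=0$).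
   Context: An almost contact metric structure $(\varphi,\xi,\eta,g)$ consists of a $(1,1)$-tensor field $\varphi$, a vector field $\xi$, a $1$-form $\eta$ and a Riemannian metric $g$ with $\varphi^2=-I+\eta\otimes\xi$, $\eta(\xi)=1$, $g(\varphi X,\varphi Y)=g(X,Y)-\eta(X)\eta(Y)$. Its fundamental form is $\Phi(X,Y)=g(X,\varphi Y)$. An almost $3$-contact metric manifold $(M,\varphi_i,\xi_i,\eta_i,g)$, $i=1,2,3$, is a manifold of dimension $4n+3$ with three almost contact metric structures with the same $g$ such that, for every even permutation $(i,j,k)$ of $(1,2,3)$, $\varphi_k=\varphi_i\varphi_j-\eta_j\otimes\xi_i=-\varphi_j\varphi_i+\eta_i\otimes\xi_j$, $\xi_k=\varphi_i\xi_j=-\varphi_j\xi_i$, $\eta_k=\eta_i\circ\varphi_j=-\eta_j\circ\varphi_i$. It is $3$-$(\alpha,\delta)$-Sasaki if $d\eta_i=2\alpha\Phi_i+2(\alpha-\delta)\eta_j\wedge\eta_k$ for every even permutation $(i,j,k)$ of $(1,2,3)$, with real constants $\alpha\neq0$, $\delta$; it is called degenerate if $\delta=0$. Conventions: $d\eta(X,Y)=X(\eta(Y))-Y(\eta(X))-\eta([X,Y])$, $(\eta\wedge\zeta)(X,Y)=\eta(X)\zeta(Y)-\eta(Y)\zeta(X)$. *)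

(* Defs.v *)
From HB Require Import structures.
From mathcomp Require Import all_boot all_order all_algebra all_fingroup.
From mathcomp Require Import sesquilinear ring.
From mathcomp Require Import all_classical all_reals all_analysis.

Set Implicit Arguments.
Unset Strict Implicit.
Unset Printing Implicit Defensive.

Import Order.TTheory GRing.Theory Num.Theory.
Import numFieldNormedType.Exports.

Local Open Scope classical_set_scope.
Local Open Scope ring_scope.

(* C^k on an open set U: all iterated partial derivatives of order at most k
   exist and are continuous on U. *)
Fixpoint Ck (R : realType) (m : nat) (W : normedModType R) (k : nat)
    (U : set 'rV[R]_m) (f : 'rV[R]_m -> W) : Prop :=
  (forall x, U x -> {for x, continuous f}) /\
  match k with
  | 0%N => True
  | k'.+1 => forall i : 'I_m,
      (forall x, U x -> derivable f x 'e_i) /\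
      Ck k' U ('D_'e_i f)
  end.

Definition smooth_on (R : realType) (m : nat) (W : normedModType R)
    (U : set 'rV[R]_m) (f : 'rV[R]_m -> W) : Prop :=
  forall k, Ck k U f.

Section CkTheory.
Context (R : realType) (m : nat).
Implicit Types (U : set 'rV[R]_m).

Lemma Ck_cont (W : normedModType R) k U (f : 'rV[R]_m -> W) :
  Ck k U f -> forall x, U x -> {for x, continuous f}.
Proof. by case: k => [|k] []. Qed.

Lemma Ck_pred (W : normedModType R) k U (f : 'rV[R]_m -> W) :
  Ck k.+1 U f -> Ck k U f.
Proof.
elim: k f => [|k IH] f [fc fd]; split=> // i.
by have [? ?] := fd i; split=> //; exact: IH.
Qed.

Lemma for_continuous_eq (V W : topologicalType) (f g : V -> W) (x : V) :
  {near x, f =1 g} -> {for x, continuous f} -> {for x, continuous g}.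
Proof.
move=> fg fc; have fgx : f x = g x by exact: nbhs_singleton fg.
move: fc; rewrite /prop_for /continuous_at fgx.
exact: cvg_trans (near_eq_cvg fg).
Qed.

Lemma Ck_eq (W : normedModType R) k U (f g : 'rV[R]_m -> W) :
  open U -> (forall x, U x -> f x = g x) -> Ck k U f -> Ck k U g.
Proof.
move=> oU.
elim: k f g => [|k IH] f g fg [fc fd];
  have nfg x : U x -> {near x, f =1 g}
    by move=> Ux; apply: filterS fg _; exact: open_nbhs_nbhs.
  by split=> // x Ux; apply: for_continuous_eq (nfg x Ux) (fc x Ux).
split=> [x Ux|i].
  exact: for_continuous_eq (nfg x Ux) (fc x Ux).
have [fdi fdk] := fd i; split=> [x Ux|].
  exact: near_eq_derivable (nfg _ Ux) (fdi _ Ux).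
by apply: IH fdk => x Ux; apply: near_eq_derive; exact: nfg.
Qed.

Lemma Ck_cst (W : normedModType R) k U (w : W) : Ck k U (cst w).
Proof.
elim: k w => [|k IH] w; (split; first by move=> x _; exact: cst_continuous).
  by [].
move=> i; split=> [x _|]; first exact: derivable_cst.
rewrite [X in Ck k U X](_ : _ = cst 0); first exact: IH.
by apply/funext => x; exact: derive_cst.
Qed.

Lemma CkD (W : normedModType R) k U (f g : 'rV[R]_m -> W) :
  open U -> Ck k U f -> Ck k U g -> Ck k U (f + g).
Proof.
move=> oU.
elim: k f g => [|k IH] f g [fc fd] [gc gd];
  (split; first by move=> x Ux; apply: continuousD; [exact: fc|exact: gc]).
  by [].
move=> i; have [fdi fdk] := fd i; have [gdi gdk] := gd i; split=> [x Ux|].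
  by apply: derivableD; [exact: fdi|exact: gdi].
apply: Ck_eq oU _ (IH _ _ fdk gdk) => x Ux.
by rewrite deriveD; [|exact: fdi|exact: gdi].
Qed.

Lemma CkM k U (f g : 'rV[R]_m -> R) :
  open U -> Ck k U f -> Ck k U g -> Ck k U (f * g).
Proof.
move=> oU.
elim: k f g => [|k IH] f g Cf Cg;
  (split; first by move=> x Ux; apply: continuousM;
                   [exact: (Ck_cont Cf)|exact: (Ck_cont Cg)]).
  by [].
have Cf' := Ck_pred Cf; have Cg' := Ck_pred Cg.
move: Cf Cg => [_ fd] [_ gd] i.
have [fdi fdk] := fd i; have [gdi gdk] := gd i; split=> [x Ux|].
  by apply: derivableM; [exact: fdi|exact: gdi].
apply: Ck_eq oU _ (CkD oU (IH _ _ Cf' gdk) (IH _ _ Cg' fdk)) => x Ux.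
by rewrite deriveM; [|exact: fdi|exact: gdi].
Qed.

End CkTheory.

(* A chart is a homeomorphism from an open subset of M onto an open subset of
   R^m; chart_map and chart_inv are only meaningful on these two sets. *)
Record chart (R : realType) (m : nat) (M : topologicalType) := Chart {
  chart_dom : set M;
  chart_cod : set 'rV[R]_m;
  chart_map : M -> 'rV[R]_m;
  chart_inv : 'rV[R]_m -> M;
  chart_dom_open : open chart_dom;
  chart_cod_open : open chart_cod;
  chart_map_cod : forall x, chart_dom x -> chart_cod (chart_map x);
  chart_inv_dom : forall y, chart_cod y -> chart_dom (chart_inv y);
  chart_mapK : forall x, chart_dom x -> chart_inv (chart_map x) = x;
  chart_invK : forall y, chart_cod y -> chart_map (chart_inv y) = y;
  chart_map_cont : forall x, chart_dom x -> {for x, continuous chart_map};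
  chart_inv_cont : forall y, chart_cod y -> {for y, continuous chart_inv} }.

(* The atlas is not required to be maximal: it determines the smooth structure,
   and smoothness below may be tested on any atlas. *)
Record smooth_manifold (R : realType) (m : nat) := SmoothManifold {
  carrier :> topologicalType;
  manifold_hausdorff : hausdorff_space carrier;
  manifold_second_countable : @second_countable carrier;
  atlas : set (chart R m carrier);
  atlas_cover : forall x : carrier, exists2 c, atlas c & chart_dom c x;
  atlas_compatible : forall c d, atlas c -> atlas d ->
    smooth_on (chart_cod c `&` chart_inv c @^-1` chart_dom d)
      (chart_map d \o chart_inv c) }.

Section SmoothFunctions.
Context (R : realType) (m : nat) (M : smooth_manifold R m).

Definition is_smooth (f : M -> R) : Prop :=
  forall c, atlas c -> smooth_on (chart_cod c) (f \o chart_inv c).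

Definition smooth_pred : {pred M -> R} := mem [set f | is_smooth f].

Lemma is_smooth_cst (r : R) : is_smooth (cst r).
Proof. by move=> c _ k; exact: Ck_cst. Qed.

Lemma is_smoothD (f g : M -> R) :
  is_smooth f -> is_smooth g -> is_smooth (f + g).
Proof.
by move=> sf sg c ac k; apply: CkD;
  [exact: chart_cod_open | exact: sf | exact: sg].
Qed.

Lemma is_smoothM (f g : M -> R) :
  is_smooth f -> is_smooth g -> is_smooth (f * g).
Proof.
by move=> sf sg c ac k; apply: CkM;
  [exact: chart_cod_open | exact: sf | exact: sg].
Qed.

Lemma is_smoothZ (r : R) (f : M -> R) : is_smooth f -> is_smooth (r *: f).
Proof. exact: is_smoothM (is_smooth_cst r). Qed.

Lemma is_smoothB (f g : M -> R) :
  is_smooth f -> is_smooth g -> is_smooth (f - g).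
Proof.
by move=> sf sg; rewrite -scaleN1r; apply: is_smoothD => //; exact: is_smoothZ.
Qed.

Lemma smooth_subring_closed : subring_closed smooth_pred.
Proof.
split=> [|f g|f g]; rewrite !inE /=.
- exact: is_smooth_cst.
- exact: is_smoothB.
- exact: is_smoothM.
Qed.
HB.instance Definition _ :=
  GRing.isSubringClosed.Build _ smooth_pred smooth_subring_closed.

Lemma smooth_scaler_closed : scaler_closed smooth_pred.
Proof. by move=> r f; rewrite !inE /=; exact: is_smoothZ. Qed.
HB.instance Definition _ :=
  GRing.isScaleClosed.Build R (M -> R) smooth_pred smooth_scaler_closed.

Record smooth_fun := SmoothFun {
  smooth_val :> M -> R;
  smooth_val_pred : smooth_val \in smooth_pred }.

HB.instance Definition _ := [isSub for smooth_val].
HB.instance Definition _ := [Choice of smooth_fun by <:].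
HB.instance Definition _ :=
  GRing.SubChoice_isSubComPzRing.Build _ _ smooth_fun smooth_subring_closed.
HB.instance Definition _ := [SubZmodule_isSubLmodule of smooth_fun by <:].

Lemma smooth_funP (f : smooth_fun) : is_smooth f.
Proof. by have := smooth_val_pred f; rewrite inE. Qed.

Definition mk_smooth (f : M -> R) (sf : is_smooth f) : smooth_fun :=
  SmoothFun (mem_set sf).

End SmoothFunctions.
Arguments smooth_fun {R m} M.

(* Tangent vectors at p are derivations at p of the algebra of global smooth
   functions; by bump functions this agrees with derivations of germs. *)
Section Tangent.
Context (R : realType) (m : nat) (M : smooth_manifold R m) (p : M).

Definition is_derivation_at (v : smooth_fun M -> R) : Prop :=
  (forall (r : R) (f h : smooth_fun M), v (r *: f + h) = r * v f + v h) /\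
  (forall f h : smooth_fun M, v (f * h) = v f * h p + f p * v h).

Definition derivation_pred : {pred smooth_fun M -> R} :=
  mem [set v | is_derivation_at v].

Lemma derivation_submod_closed : submod_closed derivation_pred.
Proof.
split=> [|a u v]; rewrite !inE /=.
  by split=> [r f h|f h]; rewrite /= ?mulr0 ?mul0r addr0.
move=> [ul um] [vl vm]; split=> [r f h|f h].
  change (a * u (r *: f + h) + v (r *: f + h) =
    r * (a * u f + v f) + (a * u h + v h)).
  by rewrite ul vl !mulrDr mulrCA addrACA.
change (a * u (f * h) + v (f * h) =
  (a * u f + v f) * h p + f p * (a * u h + v h)).
by rewrite um vm mulrDl !mulrDr mulrA [in RHS]mulrCA addrACA.
Qed.
HB.instance Definition _ :=
  GRing.isSubmodClosed.Build _ _ derivation_pred derivation_submod_closed.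

Record tangent := Tangent {
  tangent_val :> smooth_fun M -> R;
  tangent_val_pred : tangent_val \in derivation_pred }.

HB.instance Definition _ := [isSub for tangent_val].
HB.instance Definition _ := [Choice of tangent by <:].
HB.instance Definition _ := [SubChoice_isSubLmodule of tangent by <:].

Lemma tangentP (v : tangent) : is_derivation_at v.
Proof. by have := tangent_val_pred v; rewrite inE. Qed.

Definition mk_tangent (v : smooth_fun M -> R) (dv : is_derivation_at v)
  : tangent := Tangent (mem_set dv).

End Tangent.

Section TensorFields.
Context (R : realType) (m : nat) (M : smooth_manifold R m).

(* A tensor field is a family of tensors on the tangent spaces.  It is smooth
   when it sends global smooth vector fields to smooth functions or smooth
   vector fields; by bump functions this is smoothness of its coefficients in
   every chart. *)

Definition smooth_section (X : forall p : M, tangent p) : Prop :=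
  forall f : smooth_fun M, is_smooth (fun p => X p f).

Record vector_field := VectorField {
  vf_val :> forall p : M, tangent p;
  vf_smooth : smooth_section vf_val }.

Record one_form := OneForm {
  form_val :> forall p : M, {scalar (tangent p)};
  form_smooth : forall X : vector_field, is_smooth (fun p => form_val p (X p)) }.

Record endo_field := EndoField {
  endo_val :> forall p : M, {linear (tangent p) -> (tangent p)};
  endo_smooth : forall X : vector_field,
    smooth_section (fun p => endo_val p (X p)) }.

Record bilinear_field := BilinearField {
  bil_val :> forall p : M, {biscalar (tangent p)};
  bil_smooth : forall X Y : vector_field,
    is_smooth (fun p => bil_val p (X p) (Y p)) }.

Definition riemannian (g : bilinear_field) : Prop :=
  forall p : M,
    (forall u v : tangent p, g p u v = g p v u) /\
    (forall v : tangent p, v != 0 -> 0 < g p v v).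

Definition vf_apply (X : vector_field) (f : smooth_fun M) : smooth_fun M :=
  mk_smooth (vf_smooth X f).

Definition form_apply (eta : one_form) (X : vector_field) : smooth_fun M :=
  mk_smooth (form_smooth eta X).

Definition bracket_at (X Y : vector_field) (p : M) (f : smooth_fun M) : R :=
  X p (vf_apply Y f) - Y p (vf_apply X f).

Lemma vf_applyL (X : vector_field) (r : R) (f h : smooth_fun M) :
  vf_apply X (r *: f + h) = r *: vf_apply X f + vf_apply X h.
Proof.
by apply/val_inj/funext => q /=; rewrite (tangentP (X q)).1.
Qed.

Lemma vf_applyM (X : vector_field) (f h : smooth_fun M) :
  vf_apply X (f * h) = vf_apply X f * h + f * vf_apply X h.
Proof.
by apply/val_inj/funext => q /=; rewrite (tangentP (X q)).2.
Qed.

Lemma bracket_derivation (X Y : vector_field) (p : M) :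
  is_derivation_at p (bracket_at X Y p).
Proof.
have tD (v : tangent p) f h : v (f + h) = v f + v h.
  by have := (tangentP v).1 1 f h; rewrite scale1r mul1r.
split=> [r f h|f h]; rewrite /bracket_at.
  rewrite !vf_applyL !(tangentP (X p)).1 !(tangentP (Y p)).1.
  by rewrite opprD mulrBr addrACA.
rewrite !vf_applyM !tD !(tangentP (X p)).2 !(tangentP (Y p)).2 /=.
ring.
Qed.

Definition bracket_section (X Y : vector_field) (p : M) : tangent p :=
  mk_tangent (bracket_derivation X Y p).

Lemma bracket_smooth (X Y : vector_field) :
  smooth_section (bracket_section X Y).
Proof.
by move=> f; apply: is_smoothB; [exact: (vf_smooth X (vf_apply Y f))
  | exact: (vf_smooth Y (vf_apply X f))].
Qed.

Definition bracket (X Y : vector_field) : vector_field :=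
  VectorField (@bracket_smooth X Y).

Definition ext_d (eta : one_form) (X Y : vector_field) (p : M) : R :=
  X p (form_apply eta Y) - Y p (form_apply eta X) - eta p (bracket X Y p).

Definition wedge (eta zeta : one_form) (p : M) (u v : tangent p) : R :=
  eta p u * zeta p v - eta p v * zeta p u.

End TensorFields.
Arguments vector_field {R m} M.
Arguments one_form {R m} M.
Arguments endo_field {R m} M.
Arguments bilinear_field {R m} M.

Section AlmostContact.
Context (R : realType) (m : nat) (M : smooth_manifold R m).

Definition fundamental_form (phi : endo_field M) (g : bilinear_field M)
    (p : M) (u v : tangent p) : R :=
  g p u (phi p v).

Definition almost_contact_metric (phi : endo_field M) (xi : vector_field M)
    (eta : one_form M) (g : bilinear_field M) : Prop :=
  riemannian g /\
  forall p : M,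
    [/\ forall v : tangent p, phi p (phi p v) = - v + eta p v *: xi p,
        eta p (xi p) = 1
      & forall u v : tangent p,
          g p (phi p u) (phi p v) = g p u v - eta p u * eta p v].

(* The tensor fields of three almost contact structures sharing one metric;
   the indices 1, 2, 3 are the elements 0, 1, 2 of 'I_3. *)
Record tensors3 := Tensors3 {
  phi_ : 'I_3 -> endo_field M;
  xi_ : 'I_3 -> vector_field M;
  eta_ : 'I_3 -> one_form M;
  metric : bilinear_field M }.

Definition even_triple (i j k : 'I_3) : Prop :=
  exists2 s : 'S_3, ~~ odd_perm s & [/\ i = s 0, j = s 1 & k = s 2].

Definition almost_3_contact_metric (S : tensors3) : Prop :=
  (forall i, almost_contact_metric (phi_ S i) (xi_ S i) (eta_ S i) (metric S)) /\
  forall i j k, even_triple i j k -> forall p : M,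
    [/\ forall v : tangent p,
          phi_ S k p v = phi_ S i p (phi_ S j p v) - eta_ S j p v *: xi_ S i p /\
          phi_ S k p v = - phi_ S j p (phi_ S i p v) + eta_ S i p v *: xi_ S j p,
        xi_ S k p = phi_ S i p (xi_ S j p) /\
        xi_ S k p = - phi_ S j p (xi_ S i p)
      & forall v : tangent p,
          eta_ S k p v = eta_ S i p (phi_ S j p v) /\
          eta_ S k p v = - eta_ S j p (phi_ S i p v)].

End AlmostContact.
Arguments tensors3 {R m} M.

Definition sasaki3 (R : realType) (n : nat) (M : smooth_manifold R (4 * n + 3))
    (alpha delta : R) (S : tensors3 M) : Prop :=
  [/\ almost_3_contact_metric S,
      alpha != 0
    & forall i j k, even_triple i j k ->
      forall (X Y : vector_field M) (p : M),
        ext_d (eta_ S i) X Y p =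
          2 * alpha * fundamental_form (phi_ S i) (metric S) (X p) (Y p)
          + 2 * (alpha - delta) * wedge (eta_ S j) (eta_ S k) (X p) (Y p)].

Section Deformation.
Context (R : realType) (m : nat) (M : smooth_manifold R m).

Lemma vf_scale_smooth (r : R) (X : vector_field M) :
  smooth_section (fun p => r *: X p).
Proof. by move=> f; apply: is_smoothZ; exact: vf_smooth. Qed.

Definition vf_scale (r : R) (X : vector_field M) : vector_field M :=
  VectorField (vf_scale_smooth r X).

Definition form_scale_at (r : R) (eta : one_form M) (p : M) (v : tangent p) : R :=
  r * eta p v.

Lemma form_scale_linear (r : R) (eta : one_form M) (p : M) :
  scalar (@form_scale_at r eta p).
Proof.
by move=> a u v; rewrite /form_scale_at linearP mulrDr mulrCA.
Qed.
HB.instance Definition _ r eta p :=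
  GRing.isLinear.Build R (tangent p) R *%R (@form_scale_at r eta p)
    (@form_scale_linear r eta p).

Lemma form_scale_smooth (r : R) (eta : one_form M) (X : vector_field M) :
  is_smooth (fun p => form_scale_at r eta (X p)).
Proof. by apply: is_smoothZ; exact: form_smooth. Qed.

Definition form_scale (r : R) (eta : one_form M) : one_form M :=
  @OneForm _ _ M (fun p => @form_scale_at r eta p) (form_scale_smooth r eta).

Definition deformed_metric_at (a b : R) (g : bilinear_field M)
    (eta : 'I_3 -> one_form M) (p : M) (u v : tangent p) : R :=
  a * g p u v + b * \sum_(i < 3) eta i p u * eta i p v.

Lemma deformed_metric_bilinear (a b : R) (g : bilinear_field M)
    (eta : 'I_3 -> one_form M) (p : M) :
  bilinear_for *%R *%R (@deformed_metric_at a b g eta p).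
Proof.
split=> [v|u] r w z; rewrite /deformed_metric_at.
  rewrite linearPl (eq_bigr (fun i => r * (eta i p w * eta i p v)
    + eta i p z * eta i p v)) => [|i _].
    by rewrite big_split -mulr_sumr /=; ring.
  by rewrite linearP; ring.
rewrite linearPr (eq_bigr (fun i => r * (eta i p u * eta i p w)
  + eta i p u * eta i p z)) => [|i _].
  by rewrite big_split -mulr_sumr /=; ring.
by rewrite linearP; ring.
Qed.
HB.instance Definition _ a b g eta p :=
  bilinear_isBilinear.Build R (tangent p) (tangent p) R *%R *%R
    (@deformed_metric_at a b g eta p) (@deformed_metric_bilinear a b g eta p).

Lemma deformed_metric_smooth (a b : R) (g : bilinear_field M)
    (eta : 'I_3 -> one_form M) (X Y : vector_field M) :
  is_smooth (fun p => deformed_metric_at a b g eta (X p) (Y p)).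
Proof.
apply: is_smoothD; apply: is_smoothZ; first exact: bil_smooth.
rewrite (_ : (fun p => _) = \sum_(i < 3)
  ((fun p => eta i p (X p)) * (fun p => eta i p (Y p)))); last first.
  by rewrite fct_sumE.
elim/big_ind: _ => [|f h|i _].
- exact: (is_smooth_cst 0).
- exact: is_smoothD.
- by apply: is_smoothM; exact: form_smooth.
Qed.

Definition deformed_metric (a b : R) (g : bilinear_field M)
    (eta : 'I_3 -> one_form M) : bilinear_field M :=
  @BilinearField _ _ M (fun p => @deformed_metric_at a b g eta p)
    (deformed_metric_smooth a b g eta).

Definition H_homothetic (a b c : R) (S : tensors3 M) : tensors3 M :=
  {| phi_ := phi_ S;
     xi_ := fun i => vf_scale c^-1 (xi_ S i);
     eta_ := fun i => form_scale c (eta_ S i);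
     metric := deformed_metric a b (metric S) (eta_ S) |}.

End Deformation.

(* Main.v *)
(* Both the tensor identities and the equation for [d eta_i] reduce to the
   relations [eta_i \o phi_i = 0], [eta_j \o phi_i = - eta_k] and
   [eta_k \o phi_i = eta_j]: they give
   [g'(X, phi_i Y) = a g(X, phi_i Y) - b (eta_j /\ eta_k)(X, Y)],
   and [c^2 = a + b] makes the coefficients match.  For [b < 0],
   positivity of [g'] is read off
   [g' = (a + b) g - b (g - \sum_i eta_i^2)] on the diagonal, where
   [\sum_i eta_i(v)^2 <= g(v, v)] by compatibility of [g] with the [phi_i]. *)
Require Import Defs.
From mathcomp Require Import all_boot all_order all_algebra.
From mathcomp Require Import all_fingroup ring lra.
From mathcomp Require Import all_classical all_reals all_analysis.

Import Order.TTheory GRing.Theory Num.Theory.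
Local Open Scope ring_scope.

Set Implicit Arguments.
Unset Strict Implicit.

Lemma even_triple_rot (i j k : 'I_3) : even_triple i j k -> even_triple j k i.
Proof.
case=> s es [-> -> ->].
(* Composed left to right, the two transpositions form the even 3-cycle 0 -> 1 -> 2 -> 0, applied
   before [s]. *)
exists (tperm 0%R 1%R * tperm 0%R 2%R * s)%g.
  by rewrite !odd_permM !odd_tperm.
rewrite !permM tpermL tpermR (tpermD (z := 2)) // tpermL tpermR.
by rewrite (tpermD (z := 1)).
Qed.

(** Provides companions for a single index: the identity triple and its two rotations cover all
    cases. *)
Lemma even_triple_ex (i : 'I_3) : exists j k, even_triple i j k.
Proof.
have e : even_triple 0 1 2.
  by exists 1%g; rewrite ?odd_perm1 // !perm1.
case: i => -[|[|[|//]]] lti; rewrite (bool_irrelevance lti isT).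
- exists 1, 2; rewrite (_ : Ordinal _ = 0) //; exact/val_inj.
- exists 2, 0; rewrite (_ : Ordinal _ = 1); first exact: even_triple_rot.
  exact/val_inj.
- exists 0, 1; rewrite (_ : Ordinal _ = 2).
    exact/even_triple_rot/even_triple_rot.
  exact/val_inj.
Qed.

Lemma even_triple_sum (V : nmodType) (i j k : 'I_3) (e : even_triple i j k)
    (F : 'I_3 -> V) :
  \sum_(l < 3) F l = F i + F j + F k.
Proof.
case: e => s _ [-> -> ->]; rewrite (reindex_inj (@perm_inj _ s)) /=.
rewrite !big_ord_recl big_ord0 addr0 addrA.
by congr (F (s _) + F (s _) + F (s _)); apply/val_inj.
Qed.

(** [phi xi] is a multiple of [xi], and [phi (phi xi) = 0] forces the square of the factor to
    vanish; hence [eta (phi v) xi = eta v (phi xi) = 0]. *)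
Lemma eta_phi (R : realType) (m : nat) (M : smooth_manifold R m)
    (phi : endo_field M) (xi : vector_field M) (eta : one_form M)
    (g : bilinear_field M) (H : almost_contact_metric phi xi eta g)
    (p : M) (v : tangent p) :
  eta p (phi p v) = 0.
Proof.
case: H => _ /(_ p)[phi2 eta_xi _].
(* Expand [phi^3] in two ways. *)
have comm w : eta p (phi p w) *: xi p = eta p w *: phi p (xi p).
  have := phi2 (phi p w).
  by rewrite (phi2 w) linearD linearN linearZ => /addrI.
have phi_xi : phi p (xi p) = eta p (phi p (xi p)) *: xi p.
  by rewrite comm eta_xi scale1r.
have eta_phi_xi : eta p (phi p (xi p)) = 0.
  apply/eqP; rewrite -sqrf_eq0 expr2; apply/eqP.
  have := phi2 (xi p); rewrite eta_xi scale1r addNr.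
  rewrite {1}phi_xi linearZ /= {2}phi_xi scalerA => /(congr1 (eta p)).
  by rewrite linearZ linear0 /= eta_xi mulr1.
have := comm v; rewrite phi_xi eta_phi_xi scale0r scaler0 => /(congr1 (eta p)).
by rewrite linearZ linear0 /= eta_xi mulr1.
Qed.

Lemma eta_phi_next (R : realType) (m : nat) (M : smooth_manifold R m)
    (S : tensors3 M) (i j k : 'I_3) (HS : almost_3_contact_metric S)
    (e : even_triple i j k) (p : M) (v : tangent p) :
  eta_ S j p (phi_ S i p v) = - eta_ S k p v.
Proof. by have [_ _ /(_ v)[_ ->]] := HS.2 _ _ _ e p; rewrite opprK. Qed.

(** This is the [eta] identity of the rotated triple [(k, i, j)]. *)
Lemma eta_phi_prev (R : realType) (m : nat) (M : smooth_manifold R m)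
    (S : tensors3 M) (i j k : 'I_3) (HS : almost_3_contact_metric S)
    (e : even_triple i j k) (p : M) (v : tangent p) :
  eta_ S k p (phi_ S i p v) = eta_ S j p v.
Proof.
have e' := even_triple_rot (even_triple_rot e).
by have [_ _ /(_ v)[-> _]] := HS.2 _ _ _ e' p.
Qed.

(* Peel off one [eta]-component at a time along [v], [phi_i v],
   [phi_j (phi_i v)]. *)
Lemma sum_eta_sqr_le (R : realType) (m : nat) (M : smooth_manifold R m)
    (S : tensors3 M) (p : M) (v : tangent p) :
  almost_3_contact_metric S ->
  \sum_(l < 3) eta_ S l p v ^+ 2 <= metric S p v v.
Proof.
move=> HS; have [j [k e]] := even_triple_ex 0.
have compat l w : metric S p w w =
    eta_ S l p w ^+ 2 + metric S p (phi_ S l p w) (phi_ S l p w).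
  by case: (HS.1 l) => _ /(_ p)[_ _ ->]; rewrite expr2; ring.
have ge0 w : 0 <= metric S p w w.
  have [-> | w0] := eqVneq w 0; first by rewrite linear0l.
  by case: (HS.1 0) => /(_ p)[_ /(_ w w0)/ltW].
rewrite (even_triple_sum e) (compat 0 v) (compat j (phi_ S 0 p v)).
(* The second component is [- eta_k v]; the third is [eta_0 (phi_j (phi_0 v)) = eta_k (phi_0 v) =
   eta_j v]. The remainder is a squared [g]-length. *)
rewrite (compat 0 (phi_ S j p _)) (eta_phi_next HS e).
rewrite (eta_phi_prev HS (even_triple_rot e)).
rewrite (eta_phi_prev HS e) sqrrN.
have := ge0 (phi_ S 0 p (phi_ S j p (phi_ S 0 p v))).
lra.
Qed.

Lemma deformed_metric_gt0 (R : realType) (m : nat) (M : smooth_manifold R m)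
    (S : tensors3 M) (a b : R) (p : M) (v : tangent p) :
  almost_3_contact_metric S -> 0 < a -> 0 < a + b -> v != 0 ->
  0 < deformed_metric a b (metric S) (eta_ S) p v v.
Proof.
move=> HS a0 ab0 v0; rewrite /= /deformed_metric_at.
under eq_bigr do rewrite -expr2.
have gt0 : 0 < metric S p v v by case: (HS.1 0) => /(_ p)[_ /(_ v v0)].
have := sum_eta_sqr_le v HS.
have : 0 <= \sum_(l < 3) eta_ S l p v ^+ 2 by apply: sumr_ge0 => l _; exact: sqr_ge0.
move: (metric S p v v) gt0 (\sum_(l < 3) _) => G G0 s s0 sG.
have [b0 | b0] := leP 0 b; first by have := mulr_gt0 a0 G0; have := mulr_ge0 b0 s0; lra.
have : 0 <= - b * (G - s) by apply: mulr_ge0; lra.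
have := mulr_gt0 ab0 G0; lra.
Qed.

Lemma deformed_metric_phi (R : realType) (m : nat) (M : smooth_manifold R m)
    (S : tensors3 M) (i j k : 'I_3) (HS : almost_3_contact_metric S)
    (e : even_triple i j k) (a b : R) (p : M) (u v : tangent p) :
  deformed_metric a b (metric S) (eta_ S) p u (phi_ S i p v) =
  a * metric S p u (phi_ S i p v) - b * wedge (eta_ S j) (eta_ S k) u v.
Proof.
rewrite /= /deformed_metric_at (even_triple_sum e) (eta_phi (HS.1 i)).
by rewrite (eta_phi_next HS e) (eta_phi_prev HS e) /wedge; ring.
Qed.

Lemma H_homothetic_almost_contact (R : realType) (m : nat)
    (M : smooth_manifold R m) (S : tensors3 M) (a b c : R) (i : 'I_3) :
  almost_3_contact_metric S -> 0 < a -> 0 < a + b -> c != 0 ->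
  c ^+ 2 = a + b ->
  let S' := H_homothetic a b c S in
  almost_contact_metric (phi_ S' i) (xi_ S' i) (eta_ S' i) (metric S').
Proof.
move=> HS a0 ab0 c0 c2 S'.
have [riem contact] := HS.1 i; split=> [p|p].
  split=> [u v|v v0]; last exact: deformed_metric_gt0.
  rewrite /= /deformed_metric_at (riem p).1.
  by congr (_ + b * _); apply: eq_bigr => l _; rewrite mulrC.
have [phi2 eta_xi compat] := contact p.
split=> [v||u v] /=; rewrite /form_scale_at.
- by rewrite phi2 scalerA mulrAC divff // mul1r.
- by rewrite linearZ /= eta_xi mulr1 divff.
have [j [k e]] := even_triple_ex i.
(* Applying [phi_i] to both arguments kills the [i] summand and swaps the other two, so [g'] loses
   [(a + b) eta_i u eta_i v], which is [eta_i' u eta_i' v] since [c ^+ 2 = a + b]. *)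
rewrite /deformed_metric_at !(even_triple_sum e) compat.
rewrite !(eta_phi (HS.1 i)) !(eta_phi_next HS e) !(eta_phi_prev HS e).
by rewrite (mulrACA c) -[c * c]expr2 c2; ring.
Qed.

(** The factors [c] and [c^-1] cancel in each [eta_j] times [xi_i]; the identities for [xi_k] and
    [eta_k] are homogeneous. *)
Lemma H_homothetic_almost_3_contact (R : realType) (m : nat)
    (M : smooth_manifold R m) (S : tensors3 M) (a b c : R) :
  almost_3_contact_metric S -> 0 < a -> 0 < a + b -> c != 0 ->
  c ^+ 2 = a + b -> almost_3_contact_metric (H_homothetic a b c S).
Proof.
move=> HS a0 ab0 c0 c2; split=> [i|i j k e p].
  exact: H_homothetic_almost_contact.
have [phiE [xiE1 xiE2] etaE] := HS.2 i j k e p.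
split=> [v||v] /=; rewrite /form_scale_at.
- have cK t (w : tangent p) : (c * t) *: (c^-1 *: w) = t *: w.
    by rewrite scalerA mulrAC divff // mul1r.
  by rewrite !cK.
- by rewrite !linearZ /= -xiE1 -xiE2.
- by have [etaE1 etaE2] := etaE v; rewrite -mulrN -etaE1 -etaE2.
Qed.

Lemma ext_d_form_scale (R : realType) (m : nat) (M : smooth_manifold R m)
    (r : R) (eta : one_form M) (X Y : vector_field M) (p : M) :
  ext_d (form_scale r eta) X Y p = r * ext_d eta X Y p.
Proof.
have applyE Z : form_apply (form_scale r eta) Z = r *: form_apply eta Z.
  exact/val_inj.
have tangentZ (v : tangent p) f : v (r *: f) = r * v f.
  (* The scalar [-1] turns linearity at zero into [v 0 = - v 0 + v 0]. *)
  have v0 : v 0 = 0 by have := (tangentP v).1 (-1) 0 0; rewrite scaler0 addr0; lra.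
  by have := (tangentP v).1 r f 0; rewrite addr0 v0 addr0.
by rewrite /ext_d !applyE !tangentZ /= /form_scale_at; ring.
Qed.

Unset Implicit Arguments.

Theorem proposition2p3p1 (R : realType) (n : nat)
    (M : smooth_manifold R (4 * n + 3)) (S : tensors3 M)
    (alpha delta a b c : R)
    (hS : sasaki3 alpha delta S)
    (ha : 0 < a) (hab : 0 < a + b) (hc : c != 0) (hcab : c ^+ 2 = a + b) :
  let alpha' := alpha * (c / a) in
  let delta' := delta / c in
  [/\ sasaki3 alpha' delta' (H_homothetic a b c S),
      Num.sg (alpha' * delta') = Num.sg (alpha * delta)
    & delta' = 0 <-> delta = 0].
Proof.
move=> alpha' delta'; have [HS alpha0 dE] := hS.
have a0 : a != 0 by rewrite gt_eqF.
split.
- split; first exact: H_homothetic_almost_3_contact.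
    by rewrite !mulf_neq0 ?invr_eq0.
  move=> i j k e X Y p; rewrite ext_d_form_scale (dE i j k e).
  rewrite /fundamental_form (deformed_metric_phi HS e).
  rewrite /wedge /= /form_scale_at /alpha' /delta'.
  (* The coefficients match because [alpha' * a = c * alpha], [alpha' * (c ^+ 2 - b) = c * alpha]
     and [delta' * c ^+ 2 = c * delta]. *)
  have -> : b = c ^+ 2 - a by rewrite hcab; ring.
  by field; apply/andP.
(* The possibly negative [c] cancels, leaving only the positive factor [a^-1]. *)
- rewrite (_ : alpha' * delta' = a^-1 * (alpha * delta)).
    by rewrite sgrM gtr0_sg ?invr_gt0 // mul1r.
  by rewrite /alpha' /delta'; field; apply/andP.
- rewrite /delta'; split=> [/eqP|->]; last by rewrite mul0r.
  by rewrite mulf_eq0 invr_eq0 (negPf hc) orbF => /eqP.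
Qed.
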